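(* Let $A$ be a semi-infinite Jacobi matrix with off-diagonal entries $a_1,a_2,\ldots>0$ and diagonal entries $b_1,b_2,\ldots\in\mathbb{R}$, let $d\rho$ be a spectral measure of $A$, and let $s_k=\int_{-\infty}^{\infty}\lambda^k\,d\rho(\lambda)$, $k=0,1,2,\ldots$. Then for every $N\in\mathbb{N}$ $$C^N=\widetilde\Lambda_N S_0^N\left(\widetilde\Lambda_N\right)^*,\qquad B^N=\widetilde\Lambda_N S_1^N\left(\widetilde\Lambda_N\right)^*.$$ Consequently, upon introducing $g_k=\left(\widetilde\Lambda_N\right)^*f_k$, the generalized spectral problem $B^Nf_k=\lambda_kC^Nf_k$ is equivalent to the generalized spectral problem $$S^N_1g_k=\lambda_kS^N_0g_k .$$
   Context: Set $a_0=1$. A spectral measure of $A$ is the spectral measure, with respect to the first basis vector $e_1$ of $\ell^2(\mathbb{N})$, of a self-adjoint operator associated with $A$ (it is non-unique in the limit circle case); it is a probability measure with all moments finite. For $T\in\mathbb{N}$ let $\mathcal{F}^T=\mathbb{R}^T$ with elements (controls) $f=(f_0,\ldots,f_{T-1})$ and $\mathcal{H}^T=\mathbb{R}^T$ with elements $h=(h_1,\ldots,h_T)$. For a control $f$ (extended by zero), $u^f_{n,t}$ is the solution of $$u_{n,t+1}+u_{n,t-1}-a_nu_{n+1,t}-a_{n-1}u_{n-1,t}-b_nu_{n,t}=0\ (n\ge1,\ t\ge0),\quad u_{n,-1}=u_{n,0}=0\ (n\ge1),\quad u_{0,t}=f_t\ (t\ge0).$$ The control operator $W^T:\mathcal{F}^T\to\mathcal{H}^T$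 is $(W^Tf)_n=u^f_{n,T}$, $n=1,\ldots,T$, and the connecting operator is $C^T=(W^T)^*W^T$ (a $T\times T$ matrix). $D^N_-:\mathcal{F}^N\to\mathcal{F}^N$ is the shift $(D^N_-f)_0=0$, $(D^N_-f)_n=f_{n-1}$ for $n=1,\ldots,N-1$. $P:\mathcal{F}^{N+1}\to\mathcal{F}^N$ drops the last coordinate and $P^*$ appends a zero as last coordinate. The matrix $B^N$ is $$B^N=P\left(D^{N+1}_-\right)^*C^{N+1}P^*+C^ND^N_- .$$ The polynomials $\mathcal{T}_t(\lambda)$ are defined by $\mathcal{T}_0=0$, $\mathcal{T}_1=1$, $\mathcal{T}_{t+1}+\mathcal{T}_{t-1}-\lambda\mathcal{T}_t=0$. $\Lambda_N$ is the $N\times N$ lower triangular matrix (with ones on the diagonal) such that $(\mathcal{T}_1(\lambda),\ldots,\mathcal{T}_N(\lambda))^{\top}=\Lambda_N(1,\lambda,\ldots,\lambda^{N-1})^{\top}$. $J_N$ is the $N\times N$ matrix with ones on the antidiagonal and zeros elsewhere, and $\widetilde\Lambda_N=J_N\Lambda_NJ_N$. $S^N_m$ is the $N\times N$ matrix with entries $(S^N_m)_{ij}=s_{2N-i-j+m}$, $i,j=1,\ldots,N$ (so the top-left entry is $s_{2N-2+m}$ and the bottom-right entry is $s_m$). *)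

(* Defs.v *)
From HB Require Import structures.
From mathcomp Require Import all_boot all_order all_algebra.
From mathcomp Require Import all_classical all_reals all_analysis.
From mathcomp Require Import complex ring.
Set Implicit Arguments.
Unset Strict Implicit.
Unset Printing Implicit Defensive.
Import Order.TTheory GRing.Theory Num.Theory.
Import numFieldNormedType.Exports.
Local Open Scope classical_set_scope.
Local Open Scope ring_scope.

(* Vectors of ell^2({1, 2, ...}): [x k] is the component of index k + 1. *)
Section EllTwo.
Variable R : realType.
Implicit Types (x y z : nat -> R[i]).

Definition sqmod (z : R[i]) : R := complex.Re z ^+ 2 + complex.Im z ^+ 2.

Definition ell2 : set (nat -> R[i]) :=
  [set x | cvgn (series (fun k => sqmod (x k)))].

Definition sqnorm x : R := limn (series (fun k => sqmod (x k))).

Definition dot x y : R[i] :=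
  Complex (limn (series (fun k => complex.Re (x k * conjc (y k)))))
          (limn (series (fun k => complex.Im (x k * conjc (y k))))).

Definition lincomb (c : R[i]) x y : nat -> R[i] := fun k => c * x k + y k.

Definition e1 : nat -> R[i] := fun k => (k == 0%N)%:R.

End EllTwo.

(* An unbounded operator is a domain [D] with a map [H], relevant on [D] only. *)
Section SelfAdjoint.
Variable R : realType.
Implicit Types (D : set (nat -> R[i])) (H : (nat -> R[i]) -> nat -> R[i]).

Record linear_operator D H : Prop := {
  dom_ell2 : D `<=` @ell2 R ;
  ran_ell2 : forall x, D x -> ell2 (H x) ;
  dom_lincomb : forall c x y, D x -> D y -> D (lincomb c x y) ;
  op_lincomb : forall c x y, D x -> D y ->
    H (lincomb c x y) = lincomb c (H x) (H y) }.

Definition densely_defined D :=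
  forall x, ell2 x -> forall eps : R, 0 < eps ->
    exists2 y, D y & sqnorm (lincomb (-1) y x) < eps.

Definition adjoint_graph D H y z :=
  [/\ ell2 y, ell2 z & forall x, D x -> dot (H x) y = dot x z].

Record self_adjoint D H : Prop := {
  sa_linear : linear_operator D H ;
  sa_dense : densely_defined D ;
  sa_adjoint : forall y z, adjoint_graph D H y z <-> D y /\ z = H y }.

End SelfAdjoint.

Section Spectral.
Variable R : realType.
Implicit Types (E : set (measurableTypeR R) -> (nat -> R[i]) -> nat -> R[i]).
Implicit Types (mu : {measure set (measurableTypeR R) -> \bar R}).

(* <E(B) x, x> is real when E(B) is symmetric. *)
Definition scalar_measure E (x : nat -> R[i]) mu :=
  forall B, measurable B -> mu B = (complex.Re (dot (E B x) x))%:E.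

(* A resolution of the identity on the Borel sets of the line; countable
   additivity is the requirement that each B |-> <E(B) x, x> be a measure. *)
Record resolution_of_identity E : Prop := {
  roi_linear : forall B, measurable B -> linear_operator (@ell2 R) (E B) ;
  roi_symmetric : forall B x y, measurable B -> ell2 x -> ell2 y ->
    dot (E B x) y = dot x (E B y) ;
  roi_setI : forall A B x, measurable A -> measurable B -> ell2 x ->
    E (A `&` B) x = E A (E B x) ;
  roi_set0 : forall x, ell2 x -> E set0 x = (fun=> 0) ;
  roi_setT : forall x, ell2 x -> E setT x = x ;
  roi_measure : forall x, ell2 x -> exists mu, scalar_measure E x mu }.

(* H is the integral of lambda dE(lambda): x is in the domain of H iff
   lambda is square integrable for <E x, x>, and then
   <H x, x> is the integral of lambda d<E(lambda) x, x>. *)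
Definition spectral_resolution (D : set (nat -> R[i]))
    (H : (nat -> R[i]) -> nat -> R[i]) E :=
  resolution_of_identity E /\
  forall x mu, ell2 x -> scalar_measure E x mu ->
    (D x <-> (\int[mu]_t (t ^+ 2)%:E < +oo)%E) /\
    (D x -> dot (H x) x = real_complex R (Rintegral mu setT id)).

End Spectral.

(* [a n] and [b n] are the entries of index n >= 1; [a 0] is the auxiliary
   coefficient of the dynamical system and [b 0] is never used. *)
Section Jacobi.
Variables (R : realType) (a b : nat -> R).

(* Row k + 1 of A x, in accordance with the indexing of [ell2]. *)
Definition jacobi (x : nat -> R[i]) : nat -> R[i] := fun k =>
  real_complex R (a k.+1) * x k.+1
  + (if k is j.+1 then real_complex R (a k) * x j else 0)
  + real_complex R (b k.+1) * x k.

Definition finitely_supported (x : nat -> R[i]) :=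
  exists n, forall k, (n <= k)%N -> x k = 0.

(* A self-adjoint operator in ell^2 associated with A: a self-adjoint
   extension of A acting on finitely supported sequences. *)
Definition associated_operator (D : set (nat -> R[i]))
    (H : (nat -> R[i]) -> nat -> R[i]) :=
  self_adjoint D H /\
  forall x, finitely_supported x -> D x /\ H x = jacobi x.

Definition spectral_measure
    (rho : {measure set (measurableTypeR R) -> \bar R}) :=
  exists D H E, [/\ associated_operator D H, spectral_resolution D H E
    & scalar_measure E (@e1 R) rho].

(* [wave f t n] is u_{n,t}, for t >= 0; u_{n,-1} = 0 enters as the 0 of the
   innermost match. *)
Fixpoint wave (f : nat -> R) (t n : nat) {struct t} : R :=
  match t with
  | 0 => if n is 0 then f 0%N else 0
  | t'.+1 =>
    if n is 0 then f t else
      a n * wave f t' n.+1 + a n.-1 * wave f t' n.-1 + b n * wave f t' n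
      - (if t' is t''.+1 then wave f t'' n else 0)
  end.

Lemma wave0t f t : wave f t 0 = f t.
Proof. by case: t. Qed.

Lemma waven0 f n : (0 < n)%N -> wave f 0 n = 0.
Proof. by case: n. Qed.

Lemma waven1 f n : (0 < n)%N ->
  wave f 1 n + 0 - a n * wave f 0 n.+1 - a n.-1 * wave f 0 n.-1
  - b n * wave f 0 n = 0.
Proof. by case: n => // n _ /=; ring. Qed.

Lemma wavenS f t n : (0 < n)%N ->
  wave f t.+2 n + wave f t n - a n * wave f t.+1 n.+1
  - a n.-1 * wave f t.+1 n.-1 - b n * wave f t.+1 n = 0.
Proof.
case: n => // n _; set u := wave f t.+1.
have -> : wave f t.+2 n.+1 = a n.+1 * u n.+2 + a n * u n + b n.+1 * u n.+1
  - wave f t n.+1 by [].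
rewrite [n.+1.-1]/=; ring.
Qed.

Definition control (T : nat) (f : 'cV[R]_T) : nat -> R :=
  fun t => if insub t is Some i then f i 0 else 0.

Definition control_op (T : nat) (f : 'cV[R]_T) : 'cV[R]_T :=
  \col_(n < T) wave (control f) T n.+1.

Definition control_mx (T : nat) : 'M[R]_T :=
  \matrix_(n < T, s < T) control_op (delta_mx s 0) n 0.

Lemma wave_lin (I : Type) (r : seq I) (c : I -> R) (g : I -> nat -> R) f :
  (forall t, f t = \sum_(i <- r) c i * g i t) ->
  forall t n, wave f t n = \sum_(i <- r) c i * wave (g i) t n.
Proof.
move=> fE t; elim/ltn_ind: t => t IH n; case: t IH => [|t] IH.
  case: n => [|n] /=; first exact: fE.
  by rewrite big1 // => i _; rewrite mulr0.
case: n => [|n]; first by rewrite /= fE.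
rewrite [LHS]/= !(IH t) //.
have -> : (if t is t''.+1 then wave f t'' n.+1 else 0) =
   \sum_(i <- r) c i * (if t is t''.+1 then wave (g i) t'' n.+1 else 0).
  by case: t IH => [|t] IH; [rewrite big1 // => i _; rewrite mulr0 | exact: IH].
rewrite !mulr_sumr -sumrN -!big_split /=; apply: eq_bigr => i _.
by rewrite !mulrDr mulrN ![c i * (_ * _)]mulrCA.
Qed.

Lemma control_mxE T (f : 'cV[R]_T) : control_mx T *m f = control_op f.
Proof.
apply/colP => n; rewrite !mxE.
rewrite (@wave_lin _ (index_enum 'I_T) (fun s => f s 0)
  (fun s => control (delta_mx s 0))).
  by apply: eq_bigr => s _; rewrite !mxE mulrC.
move=> t; rewrite /control; case: insubP => [i _ _|_].
  rewrite (bigD1 i) //= big1 ?addr0 ?mxE ?eqxx ?mulr1 // => s si.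
  by rewrite mxE eq_sym (negbTE si) mulr0.
by rewrite big1 // => s _; rewrite mulr0.
Qed.

Definition connecting_mx (T : nat) : 'M[R]_T :=
  (control_mx T)^T *m control_mx T.

Definition shift_mx (N : nat) : 'M[R]_N :=
  \matrix_(i < N, j < N) (nat_of_ord i == j.+1)%:R.

Definition drop_last_mx (N : nat) : 'M[R]_(N, N.+1) :=
  \matrix_(i < N, j < N.+1) (nat_of_ord i == j)%:R.

Definition B_mx (N : nat) : 'M[R]_N :=
  drop_last_mx N *m (shift_mx N.+1)^T *m connecting_mx N.+1
    *m (drop_last_mx N)^T
  + connecting_mx N *m shift_mx N.

End Jacobi.

Section Moments.
Variable R : realType.

Definition moment (rho : {measure set (measurableTypeR R) -> \bar R})
    (k : nat) : R :=
  Rintegral rho setT (fun t : R => t ^+ k).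

Fixpoint chebT (t : nat) : {poly R} :=
  match t with
  | 0 => 0
  | t'.+1 => if t' is t''.+1 then 'X * chebT t' - chebT t'' else 1
  end.

Definition Lambda (N : nat) : 'M[R]_N :=
  \matrix_(i < N, j < N) (chebT i.+1)`_j.

Lemma size_chebT t : size (chebT t) = t /\ lead_coef (chebT t.+1) = 1.
Proof.
suff : [/\ size (chebT t) = t, size (chebT t.+1) = t.+1
         & lead_coef (chebT t.+1) = 1] by case.
elim: t => [|t [IH1 IH2 IH3]]; first by rewrite /= size_poly0 size_poly1 lead_coef1.
have -> : chebT t.+2 = chebT t.+1 * 'X - chebT t by rewrite /= mulrC.
have nz : chebT t.+1 != 0 by rewrite -size_poly_eq0 IH2.
have lt : leq (size (- chebT t)).+1 (size (chebT t.+1 * 'X)).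
  by rewrite size_polyN (size_mulX nz) IH1 IH2.
split; [exact: IH2 | by rewrite size_polyDl // (size_mulX nz) IH2 |].
by rewrite lead_coefDl // lead_coefMX.
Qed.

Lemma LambdaE N (x : R) :
  \col_(i < N) (chebT i.+1).[x] = Lambda N *m \col_(j < N) x ^+ j.
Proof.
apply/colP => i; rewrite !mxE (@horner_coef_wide _ N); last first.
  by rewrite (size_chebT i.+1).1.
by apply: eq_bigr => j _; rewrite !mxE.
Qed.

Definition antidiag_mx (N : nat) : 'M[R]_N :=
  \matrix_(i < N, j < N) (j == rev_ord i)%:R.

Definition Lambda_tilde (N : nat) : 'M[R]_N :=
  antidiag_mx N *m Lambda N *m antidiag_mx N.

(* Rows and columns are numbered from 1 in the formula, whence i.+1, j.+1;
   the subtractions do not truncate. *)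
Definition S_mx (s : nat -> R) (N m : nat) : 'M[R]_N :=
  \matrix_(i < N, j < N) s (2 * N - i.+1 - j.+1 + m)%N.

Definition generalized_eigenpair (N : nat) (B C : 'M[R]_N) (lambda : R)
    (f : 'cV[R]_N) :=
  f != 0 /\ B *m f = lambda *: (C *m f).

End Moments.

(* Main.v *)
(* Let mu_x(B) = <E(B)x, x>.  If x and Hx are in the domain of H, then
   d mu_{Hx} = t^2 d mu_x.  Indeed mu_{u + v} = mu_u + mu_v for u = E(B)x and
   v = y - E(B)y, so that <Hu, v> = 0 by polarization, and H commutes weakly with
   E(B); this gives <E(B)Hx, x> = int_B t d mu_x, and a second polarization gives
   the claim.  Applied to the vectors A^m e_1, which are finitely supported and
   hence in the domain, it yields s_{i+j} = <A^i e_1, A^j e_1>.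

   On the dynamical side, the response to an impulse at time s is
   u_{.,t} = T_{t-s}(A) e_1, because (T_t(A) e_1)_t and the wave satisfy the same
   recurrence.  Hence C^N_{ij} = <T_{N-i}(A) e_1, T_{N-j}(A) e_1>, while the two
   terms of B^N_{ij} add up, by the recurrence of T, to
   <T_{N-i}(A) e_1, A T_{N-j}(A) e_1>.  Expanding the polynomials gives the two
   factorizations. *)
Require Import Defs.
From HB Require Import structures.
From mathcomp Require Import all_boot all_order all_algebra.
From mathcomp Require Import all_classical all_reals all_analysis.
From mathcomp Require Import complex ring lra zify measurable_realfun.
Import Order.TTheory GRing.Theory Num.Theory.
Import numFieldNormedType.Exports.
Local Open Scope classical_set_scope.
Local Open Scope ring_scope.

Set Implicit Arguments.
Unset Strict Implicit.
Unset Printing Implicit Defensive.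

(** * Series and scalar products in ell^2 *)


Section EllTwoTheory.
Variable R : realType.
Implicit Types (x y z : nat -> R[i]) (c : R[i]).

Lemma ReM_conj (u v : R[i]) : complex.Re (u * conjc v) =
  complex.Re u * complex.Re v + complex.Im u * complex.Im v.
Proof. by case: u v => [p q] [r s] /=; ring. Qed.

Lemma ImM_conj (u v : R[i]) : complex.Im (u * conjc v) =
  complex.Im u * complex.Re v - complex.Re u * complex.Im v.
Proof. by case: u v => [p q] [r s] /=; ring. Qed.

Lemma ReM (u v : R[i]) : complex.Re (u * v) =
  complex.Re u * complex.Re v - complex.Im u * complex.Im v.
Proof. by case: u v => [p q] [r s] /=; ring. Qed.

Lemma ImM (u v : R[i]) : complex.Im (u * v) =
  complex.Im u * complex.Re v + complex.Re u * complex.Im v.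
Proof. by case: u v => [p q] [r s] /=; ring. Qed.

Lemma sqmod_ge0 (u : R[i]) : 0 <= sqmod u.
Proof. by rewrite addr_ge0 ?sqr_ge0. Qed.

(** The right side minus the left side is the squared modulus of [c * u - v]. *)
Lemma sqmod_lin_le (c u v : R[i]) :
  sqmod (c * u + v) <= 2 * sqmod c * sqmod u + 2 * sqmod v.
Proof.
rewrite /sqmod; case: c u v => [p q] [r s] [t w] /=.
have := sqr_ge0 (p * r - q * s - t); have := sqr_ge0 (p * s + q * r - w); nra.
Qed.

Lemma norm_ReM_conj_le (u v : R[i]) :
  `|complex.Re (u * conjc v)| <= sqmod u + sqmod v.
Proof.
rewrite ReM_conj /sqmod ler_norml; case: u v => [r s] [t w] /=.
have := sqr_ge0 (r + t); have := sqr_ge0 (s + w).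
have := sqr_ge0 (r - t); have := sqr_ge0 (s - w).
have := sqr_ge0 r; have := sqr_ge0 s; have := sqr_ge0 t; have := sqr_ge0 w.
by move=> *; apply/andP; split; nra.
Qed.

Lemma norm_ImM_conj_le (u v : R[i]) :
  `|complex.Im (u * conjc v)| <= sqmod u + sqmod v.
Proof.
rewrite ImM_conj /sqmod ler_norml; case: u v => [r s] [t w] /=.
have := sqr_ge0 (s + t); have := sqr_ge0 (r + w).
have := sqr_ge0 (s - t); have := sqr_ge0 (r - w).
have := sqr_ge0 r; have := sqr_ge0 s; have := sqr_ge0 t; have := sqr_ge0 w.
by move=> *; apply/andP; split; nra.
Qed.

Lemma series_abs_cvg (u v : nat -> R) : (forall k, `|u k| <= v k) ->
  cvgn (series v) -> cvgn (series u).
Proof.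
move=> uv cv; apply: normed_cvg; apply: series_le_cvg cv => //= k.
exact: le_trans (uv k).
Qed.

Lemma ell2_lincomb c x y : ell2 x -> ell2 y -> ell2 (lincomb c x y).
Proof.
rewrite /ell2 /= => hx hy.
apply: (@series_abs_cvg _ (2 * sqmod c *: (fun k => sqmod (x k))
  + 2 *: (fun k => sqmod (y k)))).
  by move=> k; rewrite ger0_norm ?sqmod_ge0 //; exact: sqmod_lin_le.
by apply: is_cvg_seriesD; apply: is_cvg_seriesZ.
Qed.

Lemma cvg_Re_dot x y : ell2 x -> ell2 y ->
  cvgn (series (fun k => complex.Re (x k * conjc (y k)))).
Proof.
move=> hx hy.
apply: (@series_abs_cvg _ ((fun k => sqmod (x k)) + (fun k => sqmod (y k)))).
  by move=> k; exact: norm_ReM_conj_le.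
exact: is_cvg_seriesD.
Qed.

Lemma cvg_Im_dot x y : ell2 x -> ell2 y ->
  cvgn (series (fun k => complex.Im (x k * conjc (y k)))).
Proof.
move=> hx hy.
apply: (@series_abs_cvg _ ((fun k => sqmod (x k)) + (fun k => sqmod (y k)))).
  by move=> k; exact: norm_ImM_conj_le.
exact: is_cvg_seriesD.
Qed.

Lemma dot_lincombl c x y z : ell2 x -> ell2 y -> ell2 z ->
  dot (lincomb c x y) z = c * dot x z + dot y z.
Proof.
move=> hx hy hz; have Rx := cvg_Re_dot hx hz; have Ix := cvg_Im_dot hx hz.
have Ry := cvg_Re_dot hy hz; have Iy := cvg_Im_dot hy hz.
have Zr k (u : nat -> R) : cvgn (series u) ->
    limn (series (k *: u)) = k * limn (series u).
  exact: lim_seriesZ.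
have cZ k (u : nat -> R) : cvgn (series u) -> cvgn (series (k *: u)).
  exact: is_cvg_seriesZ.
apply/eqP; rewrite eq_complex; apply/andP; split; apply/eqP.
  rewrite [LHS]/= raddfD /= ReM /= -!Zr //.
  rewrite -(lim_seriesB (cZ _ _ Rx) (cZ _ _ Ix)).
  rewrite -(lim_seriesD (is_cvg_seriesB (cZ _ _ Rx) (cZ _ _ Ix)) Ry).
  congr (limn (series _)); apply/funext => k.
  by rewrite /lincomb mulrDl raddfD /= -mulrA ReM.
rewrite [LHS]/= raddfD /= ImM /= -!Zr //.
rewrite -(lim_seriesD (cZ _ _ Rx) (cZ _ _ Ix)).
rewrite -(lim_seriesD (is_cvg_seriesD (cZ _ _ Rx) (cZ _ _ Ix)) Iy).
congr (limn (series _)); apply/funext => k.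
by rewrite /lincomb mulrDl raddfD /= -mulrA ImM.
Qed.

Lemma dot_conj x y : ell2 x -> ell2 y -> dot x y = conjc (dot y x).
Proof.
move=> hx hy; rewrite /dot /=; congr Complex.
  by congr (limn (series _)); apply/funext => k; rewrite !ReM_conj; ring.
rewrite -lim_seriesN; last exact: cvg_Im_dot.
congr (limn (series _)); apply/funext => k.
by rewrite /GRing.opp /= !ImM_conj; ring.
Qed.

Lemma dot_lincombr c x y z : ell2 x -> ell2 y -> ell2 z ->
  dot z (lincomb c x y) = conjc c * dot z x + dot z y.
Proof.
move=> hx hy hz.
rewrite (dot_conj hz (@ell2_lincomb c _ _ hx hy)) dot_lincombl //.
by rewrite rmorphD rmorphM (dot_conj hz hx) (dot_conj hz hy).
Qed.

(** For c = 1 or -1 the product of c with its conjugate is 1: the diagonal terms do not see the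
    sign, the cross terms carry it. Subtracting the two cases is the polarization used below. *)
Lemma dot_lincomb_sym (c : R[i]) x y z w :
  ell2 x -> ell2 y -> ell2 z -> ell2 w -> c = 1 \/ c = -1 ->
  complex.Re (dot (lincomb c x y) (lincomb c z w)) =
  complex.Re (dot x z + dot y w) + complex.Re (c * (dot x w + dot y z)).
Proof.
move=> hx hy hz hw c1; rewrite -raddfD; congr complex.Re.
have hzw := ell2_lincomb (c := c) hz hw.
rewrite dot_lincombl // !dot_lincombr //.
by case: c1 => ->; rewrite ?rmorphN1 ?rmorph1; ring.
Qed.

Lemma cvg_series_finite (V : normedModType R) (u : nat -> V) n :
  (forall k, (n <= k)%N -> u k = 0) -> series u @ \oo --> \sum_(k < n) u k.
Proof.
move=> u0; apply: cvg_near_cst; near=> m.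
have nm : (n <= m)%N by near: m; exact: nbhs_infty_ge.
apply/eqP; rewrite /series /= -(subnKC nm) -(big_mkord xpredT u).
rewrite (@big_cat_nat _ _ _ n) ?leq_addr //=.
rewrite [X in _ + X]big_nat_cond [X in _ + X]big1 ?addr0 // => k.
by case/andP => /andP[/u0].
Unshelve. all: by end_near. Qed.

Lemma ell2_finite x : finitely_supported x -> ell2 x.
Proof.
move=> [n xn]; rewrite /ell2 /=; apply/cvg_ex; eexists.
apply: (@cvg_series_finite _ _ n) => k nk.
by rewrite /sqmod (xn _ nk) /= expr0n addr0.
Qed.

Lemma dot_finite x y n : (forall k, (n <= k)%N -> x k = 0) ->
  dot x y = \sum_(k < n) x k * conjc (y k).
Proof.
move=> xn; apply/eqP; rewrite eq_complex; apply/andP; split; apply/eqP.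
  rewrite [LHS]/= raddf_sum; apply/cvg_lim => //.
  by apply: cvg_series_finite => k nk; rewrite xn // mul0r.
rewrite [LHS]/= raddf_sum; apply/cvg_lim => //.
by apply: cvg_series_finite => k nk; rewrite xn // mul0r.
Qed.

End EllTwoTheory.

(** * Measures with a density *)

Section Density.
Local Open Scope ereal_scope.
Context d (T : measurableType d) (R : realType).
Variables (mu nu : {measure set T -> \bar R}) (E : set T) (mE : measurable E).
Variables (f : T -> R).
Hypothesis f0 : forall x, E x -> (0 <= f x)%R.
Hypothesis mf : measurable_fun E f.
Hypothesis nuE : forall A, measurable A -> A `<=` E ->
  nu A = \int[mu]_(x in A) (f x)%:E.

Import HBNNSimple.

Lemma integral_density_indic (A : set T) : measurable A ->
  \int[nu]_(x in E) (\1_A x)%:E = \int[mu]_(x in E) ((f x)%:E * (\1_A x)%:E).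
Proof.
move=> mA; rewrite integral_indic // nuE //; last exact: measurableI.
rewrite setIC integral_mkcondr; apply: eq_integral => x _.
by rewrite epatch_indic.
Qed.

(** Monotone convergence on both sides, along simple functions increasing to [g], reduces the claim
    to indicators by linearity. *)
Lemma ge0_integral_density (g : T -> \bar R) :
  (forall x, E x -> 0 <= g x) -> measurable_fun E g ->
  \int[nu]_(x in E) g x = \int[mu]_(x in E) ((f x)%:E * g x).
Proof.
move=> g0 mg; pose h := nnsfun_approx mE mg.
have hg x : E x -> (h n x)%:E @[n --> \oo] --> g x.
  by move=> Ex; exact: cvg_nnsfun_approx.
have hnd x n m : (n <= m)%N -> (h n x <= h m x)%R.
  by move=> nm; exact/lefP/nd_nnsfun_approx.
have mh n : measurable_fun E (fun x => (h n x)%:E).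
  exact/measurable_EFinP/measurable_funTS.
have mf' : measurable_fun E (EFin \o f) by exact/measurable_EFinP.
transitivity (limn (fun n => \int[nu]_(x in E) (h n x)%:E)).
  rewrite -monotone_convergence //.
  - by apply: eq_integral => x /[!inE] Ex; apply/esym/cvg_lim => //; exact: hg.
  - by move=> n x _; rewrite lee_fin.
  - by move=> x _ m n mn; rewrite lee_fin hnd.
transitivity (limn (fun n =>
    \int[mu]_(x in E) ((f x)%:E * (h n x)%:E))); last first.
  rewrite -monotone_convergence //.
  - apply: eq_integral => x /[!inE] Ex; apply/cvg_lim => //.
    by apply: cvgeZl => //; exact: hg.
  - by move=> n; exact: emeasurable_funM.
  - by move=> n x Ex; rewrite mule_ge0 ?lee_fin ?f0 //.
  - by move=> x Ex m n mn; rewrite lee_pmul ?lee_fin ?f0 ?hnd.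
congr (limn _); apply/funext => n.
have ind r : measurable_fun E (fun x => (\1_(h n @^-1` [set r]) x)%:E : \bar R).
  by apply/measurable_EFinP/measurable_funTS.
have hE x : (h n x)%:E =
    \sum_(r \in range (h n)) (r%:E * (\1_(h n @^-1` [set r]) x)%:E).
  by rewrite fimfunE -fsumEFin.
under eq_integral do rewrite hE.
under [RHS]eq_integral => x xE.
  rewrite hE ge0_mule_fsumr; last by move=> r; exact: nnfun_muleindic_ge0.
  over.
have mrind r : measurable_fun E
    (fun x => r%:E * (\1_(h n @^-1` [set r]) x)%:E : \bar R).
  by apply: emeasurable_funM; [exact: measurable_cst|exact: ind].
have rind0 r x : 0 <= r%:E * (\1_(h n @^-1` [set r]) x)%:E.
  exact: nnfun_muleindic_ge0.
rewrite !ge0_integral_fsum //;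
  [ | by move=> r; exact: emeasurable_funM
    | by move=> r x Ex; rewrite mule_ge0 ?rind0 ?lee_fin ?f0].
apply: eq_fsbigr => r /[!inE] -[y _ <-].
under [RHS]eq_integral do rewrite muleCA.
rewrite !ge0_integralZl ?lee_fin //.
- by rewrite integral_density_indic.
- exact: emeasurable_funM.
- by move=> x Ex; rewrite mule_ge0 ?lee_fin ?f0.
Qed.
End Density.

Section DensityMeasure.
Local Open Scope ereal_scope.
Context d (T : measurableType d) (R : realType).
Variables (mu : {measure set T -> \bar R}) (f : T -> R).
Hypotheses (f0 : forall x, (0 <= f x)%R) (mf : measurable_fun setT f).

(* [f0] and [mf] are arguments, though unused, so that the measure structure
   can be inferred. *)
Definition mdensity (f0 : forall x, (0 <= f x)%R)
  (mf : measurable_fun setT f) (A : set T) := \int[mu]_(x in A) (f x)%:E.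

Let density0 : mdensity f0 mf set0 = 0.
Proof. exact: integral_set0. Qed.

Let density_ge0 A : 0 <= mdensity f0 mf A.
Proof. by apply: integral_ge0 => x _; rewrite lee_fin. Qed.

Let density_sigma_additive : semi_sigma_additive (mdensity f0 mf).
Proof.
apply: semi_sigma_additive_nng_induced; last by move=> x; rewrite lee_fin.
exact/measurable_EFinP.
Qed.

HB.instance Definition _ := isMeasure.Build _ _ _ (mdensity f0 mf)
  density0 density_ge0 density_sigma_additive.
End DensityMeasure.

Section MeasureLemmas.
Local Open Scope ereal_scope.
Context d (T : measurableType d) (R : realType).
Implicit Types (mu nu : {measure set T -> \bar R}).

(** The restriction has density [\1_B]. A general [g] is split into positive and negative parts,
    which covers infinite integrals as well. *)
Lemma integral_mrestr mu (B : set T) (mB : measurable B) (g : T -> \bar R) :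
  measurable_fun setT g ->
  \int[mrestr mu mB]_x g x = \int[mu]_(x in B) g x.
Proof.
move=> mg.
have pos (h : T -> \bar R) : measurable_fun setT h -> (forall x, 0 <= h x) ->
    \int[mrestr mu mB]_x h x = \int[mu]_(x in B) h x.
  move=> mh h0.
  rewrite (@ge0_integral_density _ _ _ mu (mrestr mu mB) _ _ (\1_B)) //.
  - rewrite [RHS]integral_mkcond; apply: eq_integral => x _.
    by rewrite epatch_indic muleC.
  - by move=> A mA _; rewrite integral_indic // /mrestr setIC.
rewrite (integralE (mrestr mu mB)) (integralE mu) !pos //.
  exact: measurable_funeneg.
exact: measurable_funepos.
Qed.

(** Integrating [h] over [E] against [nu1] gives its integral against [nu2] plus four times the
    integral of [h ^+ 2] against [mu]; comparison with the last hypothesis isolates [kappa]. The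
    additive form avoids signed measures. *)
Lemma density_square mu nu1 nu2 (kappa : \bar R) (E : set T) (h : T -> R) :
  measurable E -> measurable_fun setT h -> (forall x, 0 <= h x)%R ->
  (forall A, measurable A -> A `<=` E ->
    nu1 A = nu2 A + \int[mu]_(x in A) (4 * h x)%:E) ->
  \int[nu2]_(x in E) (h x)%:E < +oo ->
  \int[nu1]_(x in E) (h x)%:E = \int[nu2]_(x in E) (h x)%:E + 4%:E * kappa ->
  kappa = \int[mu]_(x in E) (h x ^+ 2)%:E.
Proof.
move=> mE mh h0 nuE fin; have h40 x : (0 <= 4 * h x)%R by rewrite mulr_ge0.
have mh4 : measurable_fun setT (fun x => 4 * h x)%R by exact: measurable_funM.
have mhE : measurable_fun E (fun x => (h x)%:E).
  by apply/measurable_EFinP; exact: measurable_funTS.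
rewrite (eq_measure_integral (measure_add nu2 (mdensity mu h40 mh4))); last first.
  move=> A mA AE; rewrite nuE //; apply/esym.
  exact: (measure_addE nu2 (mdensity mu h40 mh4)).
rewrite ge0_integral_measure_add //; last by move=> x _; rewrite lee_fin.
rewrite (@ge0_integral_density _ _ _ mu (mdensity mu h40 mh4) _ _
  (fun x => 4 * h x)%R) //; last 2 first.
- exact: measurable_funTS.
- by move=> x _; rewrite lee_fin.
have finE : \int[nu2]_(x in E) (h x)%:E \is a fin_num.
  by rewrite ge0_fin_numE // integral_ge0 // => x _; rewrite lee_fin.
under [X in _ + X]eq_integral do rewrite -EFinM -mulrA -expr2 EFinM.
rewrite ge0_integralZl //; first last.
- by move=> x _; rewrite lee_fin sqr_ge0.
- apply/measurable_EFinP; apply: measurable_funX; exact: measurable_funTS.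
(* The common term can be subtracted because it is finite. *)
move=> /(congr1 (fun z => z - \int[nu2]_(x in E) (h x)%:E)).
rewrite ![_ + _ * _]addeC !addeK //.
move=> /(congr1 (fun z => (4^-1)%:E * z)).
by rewrite !muleA -!EFinM mulVf ?mul1e // => ->.
Qed.
End MeasureLemmas.

(** Since s is 1 or -1, [s * t] equals |t| on [B]. There [nu1] exceeds [nu2] by a measure of density
    4|t|, and the last hypothesis times s says that the integral of |t| grows by 4k, which is the
    setting of [density_square]. *)
Lemma square_of_signed_density (R : realType) (s k : R)
    (mu nu1 nu2 : {measure set (measurableTypeR R) -> \bar R})
    (B : set (measurableTypeR R)) :
  s ^+ 2 = 1 -> measurable B -> B `<=` [set t | 0 <= s * t] ->
  mu.-integrable setT (fun t : measurableTypeR R => t%:E) ->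
  nu1.-integrable setT (fun t : measurableTypeR R => t%:E) ->
  nu2.-integrable setT (fun t : measurableTypeR R => t%:E) ->
  (forall A, measurable A ->
    nu1 A = (nu2 A + (4 * s * Rintegral mu A id)%:E)%E) ->
  Rintegral nu1 B id = Rintegral nu2 B id + 4 * s * k ->
  k%:E = (\int[mu]_(t in B) (t ^+ 2)%:E)%E.
Proof.
move=> s2 mB Bs imu inu1 inu2 nu12 nuk.
have intS (m : {measure set (measurableTypeR R) -> \bar R}) A :
    m.-integrable setT (fun t : measurableTypeR R => t%:E) ->
    measurable A -> m.-integrable A (fun t : measurableTypeR R => t%:E).
  by move=> im mA; exact: integrableS im.
(* The maximum with 0 makes [h] nonnegative on the whole line without changing it on [B]. *)
pose h (t : measurableTypeR R) : R := Num.max (s * t) 0.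
have hE t : B t -> h t = s * t by move/Bs => st; rewrite /h max_l.
have inth (m : {measure set (measurableTypeR R) -> \bar R}) A :
    m.-integrable setT (fun t : measurableTypeR R => t%:E) ->
    measurable A -> A `<=` B ->
    (\int[m]_(t in A) (h t)%:E)%E = (s * Rintegral m A id)%:E.
  move=> im mA AB; rewrite EFinM /Rintegral fineK; last first.
    by apply: integrable_fin_num => //; exact: intS.
  rewrite -integralZl //; last exact: intS.
  by apply: eq_integral => t /[!inE] /AB /hE ->.
have mh : measurable_fun setT h.
  by apply: measurable_maxr => //; exact: measurable_funM.
have h0 t : 0 <= h t by rewrite le_max lexx orbT.
rewrite (@density_square _ _ _ mu nu1 nu2 k%:E B h) //.
- by apply: eq_integral => t /[!inE] Bt; rewrite hE // exprMn s2 mul1r.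
- move=> A mA AB; rewrite nu12 //; congr (_ + _)%E.
  under eq_integral do rewrite EFinM.
  rewrite ge0_integralZl //.
  + by rewrite inth // -EFinM mulrA.
  + by apply/measurable_EFinP; exact: measurable_funTS.
  + by move=> t _; rewrite lee_fin.
- by rewrite inth // ltry.
- rewrite !inth // -!EFinM -EFinD nuk; congr (_%:E).
  have -> : s * (Rintegral nu2 B id + 4 * s * k) =
    s * Rintegral nu2 B id + 4 * (s ^+ 2 * k) by ring.
  by rewrite s2 mul1r.
Qed.

(** Multiplication by the nonnegative [f] commutes with taking positive and negative parts. *)
Lemma integral_density d (T : measurableType d) (R : realType)
    (mu nu : {measure set T -> \bar R}) (f g : T -> R) :
  (forall x, 0 <= f x) -> measurable_fun setT f -> measurable_fun setT g ->
  (forall A, measurable A -> nu A = (\int[mu]_(x in A) (f x)%:E)%E) ->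
  (\int[nu]_x (g x)%:E = \int[mu]_x (f x * g x)%:E)%E.
Proof.
move=> f0 mf mg nuE.
have pos (h : T -> \bar R) :
    measurable_fun setT h -> (forall x, (0 <= h x)%E) ->
    (\int[nu]_x h x = \int[mu]_x ((f x)%:E * h x))%E.
  move=> mh h0; apply: ge0_integral_density => // A mA _; exact: nuE.
have mg' : measurable_fun setT (EFin \o g) by exact/measurable_EFinP.
rewrite (integralE nu) (integralE mu) !pos //; first last.
- exact: measurable_funepos.
- exact: measurable_funeneg.
congr (_ - _)%E; apply: eq_integral => x _.
  by rewrite !funeposE /= -!EFin_max -EFinM maxr_pMr // mulr0.
by rewrite !funenegE /= -!EFin_max -EFinM maxr_pMr // mulr0 mulrN.
Qed.

(** * Resolutions of the identity *)

Section SpectralResolution.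
Variables (R : realType) (D : set (nat -> R[i])).
Variables (H : (nat -> R[i]) -> nat -> R[i]).
Variables (E : set (measurableTypeR R) -> (nat -> R[i]) -> nat -> R[i]).
Hypotheses (sa : self_adjoint D H) (sr : spectral_resolution D H E).
Implicit Types (x y : nat -> R[i]) (B : set (measurableTypeR R)).
Implicit Types (mu : {measure set (measurableTypeR R) -> \bar R}).

Let roi : resolution_of_identity E := proj1 sr.
Let Dl2 x : D x -> ell2 x. Proof. exact: (dom_ell2 (sa_linear sa)). Qed.
Let Hl2 x : D x -> ell2 (H x). Proof. exact: (ran_ell2 (sa_linear sa)). Qed.
Let El2 B x : measurable B -> ell2 x -> ell2 (E B x).
Proof. move=> mB; exact: (ran_ell2 (roi_linear roi mB)). Qed.
Let Dlin c x y : D x -> D y -> D (lincomb c x y).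
Proof. exact: (dom_lincomb (sa_linear sa)). Qed.
Let Hlin c x y : D x -> D y -> H (lincomb c x y) = lincomb c (H x) (H y).
Proof. exact: (op_lincomb (sa_linear sa)). Qed.
Let Elin B c x y : measurable B -> ell2 x -> ell2 y ->
  E B (lincomb c x y) = lincomb c (E B x) (E B y).
Proof. move=> mB; exact: (op_lincomb (roi_linear roi mB)). Qed.
Let Esym B x y : measurable B -> ell2 x -> ell2 y ->
  dot (E B x) y = dot x (E B y).
Proof. exact: roi_symmetric. Qed.

Lemma self_adjoint_symmetric x y : D x -> D y -> dot (H x) y = dot x (H y).
Proof.
move=> Dx Dy.
by have [_ _ ->] := (sa_adjoint sa y (H y)).2 (conj Dy erefl).
Qed.

(** The right-hand [E B] moves across by symmetry, and multiplicativity absorbs the repeated [B]. *)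
Lemma dot_proj2 A B x y : measurable A -> measurable B -> ell2 x -> ell2 y ->
  dot (E A (E B x)) (E B y) = dot (E (A `&` B) x) y.
Proof.
move=> mA mB hx hy; have hBx := El2 mB hx; have hABx := El2 mA hBx.
rewrite -(Esym mB hABx hy) -(roi_setI roi mB mA hBx).
by rewrite -(roi_setI roi (measurableI _ _ mB mA) mB hx) setIAC setIid setIC.
Qed.

Lemma scalar_measure_exists x : ell2 x -> exists mu, scalar_measure E x mu.
Proof. exact: roi_measure. Qed.

Lemma domE x mu : ell2 x -> scalar_measure E x mu ->
  D x <-> (\int[mu]_t (t ^+ 2)%:E < +oo)%E.
Proof. by move=> hx hmu; exact: (proj1 (proj2 sr x mu hx hmu)). Qed.

Lemma quadratic_form x mu : D x -> scalar_measure E x mu ->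
  dot (H x) x = real_complex R (Rintegral mu setT id).
Proof. by move=> Dx hmu; exact: (proj2 (proj2 sr x mu (Dl2 Dx) hmu)). Qed.

Lemma scalar_measure_finite x mu A : scalar_measure E x mu -> measurable A ->
  mu A \is a fin_num.
Proof. by move=> h mA; rewrite h. Qed.

(** |t| is at most 1 + t^2, the measure is finite, and membership in [D] bounds its second
    moment. *)
Lemma integrable_id x mu : D x -> scalar_measure E x mu ->
  mu.-integrable setT (fun t : measurableTypeR R => t%:E).
Proof.
move=> Dx h; have sq := (domE (Dl2 Dx) h).1 Dx.
have mid : measurable_fun setT (fun t : measurableTypeR R => t : R).
  exact: measurable_id.
have msq : measurable_fun setT (fun t : measurableTypeR R => t ^+ 2 : R).
  exact: measurable_funX.
apply: (@le_integrable _ _ _ _ _ _ _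
  (fun t : measurableTypeR R => (1 + (t : R) ^+ 2)%:E)) => //.
- exact/measurable_EFinP.
- move=> t _; rewrite lee_fin [X in _ <= X]ger0_norm ?addr_ge0 ?sqr_ge0 //.
  have := sqr_ge0 (t - 1); have := sqr_ge0 (t + 1).
  by rewrite ler_norml => ??; apply/andP; split; nra.
- apply/integrableP; split; first by apply/measurable_EFinP/measurable_funD.
  under eq_integral => t _.
    rewrite /= ger0_norm ?addr_ge0 ?sqr_ge0 // EFinD.
    over.
  rewrite ge0_integralD //; first last.
  + exact/measurable_EFinP.
  + by move=> t _; rewrite lee_fin sqr_ge0.
  rewrite integral_cst // mul1e lte_add_pinfty //.
  by rewrite ltey_eq (scalar_measure_finite h).
Qed.

Lemma scalar_measure_proj x mu B (mB : measurable B) : ell2 x ->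
  scalar_measure E x mu -> scalar_measure E (E B x) (mrestr mu mB).
Proof.
move=> hx h A mA; rewrite [LHS]/= /mrestr h; last exact: measurableI.
by rewrite dot_proj2.
Qed.

(** Membership in [D] is a bound on the second moment, which can only decrease when the measure is
    restricted to [B]. *)
Lemma dom_proj x B : measurable B -> D x -> D (E B x).
Proof.
move=> mB Dx; have [mu h] := scalar_measure_exists (Dl2 Dx).
have sq := (domE (Dl2 Dx) h).1 Dx.
apply/(domE (El2 mB (Dl2 Dx)) (scalar_measure_proj mB (Dl2 Dx) h)).
have msq : measurable_fun setT (fun t : measurableTypeR R => (t ^+ 2)%:E).
  by apply/measurable_EFinP; apply: measurable_funX.
rewrite integral_mrestr //; apply: le_lt_trans sq.
by apply: ge0_subset_integral => // t _; rewrite lee_fin sqr_ge0.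
Qed.

Lemma scalar_measure_coproj x mu B (mB : measurable (~` B)) :
  measurable B -> ell2 x -> scalar_measure E x mu ->
  scalar_measure E (lincomb (-1) (E B x) x) (mrestr mu mB).
Proof.
move=> mB' hx h A mA; rewrite [LHS]/= /mrestr.
have mAB : measurable (A `&` B) by exact: measurableI.
have -> : mu (A `&` ~` B) = (mu A - mu (A `&` B))%E.
  rewrite [X in (X - _)%E](measureDI mu mA mB') setDE addeK //.
  by rewrite (scalar_measure_finite h).
rewrite !h // -EFinB; congr (_%:E).
have hEx := El2 mB' hx; have hAx := El2 mA hx; have hABx := El2 mA hEx.
have l2 : ell2 (lincomb (-1) (E B x) x) by exact: ell2_lincomb.
(* Of the four terms of <E(A)(x - E(B)x), x - E(B)x>, the three involving E(B) agree up to sign; one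
   copy remains, subtracted. *)
rewrite Elin // dot_lincombl // !dot_lincombr // dot_proj2 //.
rewrite -(Esym mB' hAx hx) -(roi_setI roi mA mB' hx) -(roi_setI roi mB' mA hx).
by rewrite (setIC B A) !rmorphN1 !mulN1r addNr oppr0 add0r [in RHS]addrC raddfB.
Qed.

(* The spectral measure of [u + v], with [u = E B x] and [v = y - E B y], is the
   sum of those of [u] and [v], hence so is the quadratic form of [H]: the cross
   terms cancel, although [H] is not yet known to commute with [E B]. *)
Lemma Re_cross_eq0 x y B : measurable B -> D x -> D y ->
  complex.Re (dot (H (E B x)) (lincomb (-1) (E B y) y)) = 0.
Proof.
move=> mB Dx Dy; have mBC : measurable (~` B) by exact: measurableC.
set u := E B x; set v := lincomb (-1) (E B y) y.
have [mux hmux] := scalar_measure_exists (Dl2 Dx).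
have [muy hmuy] := scalar_measure_exists (Dl2 Dy).
have hu := scalar_measure_proj mB (Dl2 Dx) hmux.
have hv := scalar_measure_coproj mBC mB (Dl2 Dy) hmuy.
rewrite -/u in hu; rewrite -/v in hv.
have Du : D u by exact: dom_proj.
have Dv : D v by apply: Dlin => //; exact: dom_proj.
have u2 := Dl2 Du; have v2 := Dl2 Dv.
(* [E A u] stays in the range of E(B), to which [v] is orthogonal. *)
have hAuv A : measurable A -> dot (E A u) v = 0.
  move=> mA; have Au2 := El2 mA u2.
  rewrite dot_lincombr //; [|exact: El2 (Dl2 Dy)|exact: Dl2].
  rewrite dot_proj2 //; [|exact: Dl2|exact: Dl2].
  by rewrite -(roi_setI roi mA mB (Dl2 Dx)) rmorphN1 mulN1r addNr.
clearbody u v.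
have huv : scalar_measure E (lincomb 1 u v)
    (measure_add (mrestr mux mB) (mrestr muy mBC)).
  move=> A mA; rewrite [LHS](measure_addE (mrestr mux mB) (mrestr muy mBC)).
  rewrite hu // hv // -EFinD; congr (_%:E).
  have Au2 := El2 mA u2; have Av2 := El2 mA v2.
  have uv2 := ell2_lincomb (c := 1) u2 v2.
  rewrite Elin // dot_lincombl // !dot_lincombr // hAuv //.
  have -> : dot (E A v) u = 0.
    by rewrite Esym // dot_conj // hAuv // rmorph0.
  by rewrite rmorph1 !mul1r addr0 add0r raddfD.
have Duv : D (lincomb 1 u v) by exact: Dlin.
have := quadratic_form Duv huv.
rewrite /Rintegral integral_measure_add //; last 2 first.
- exact: integrable_id Du hu.
- exact: integrable_id Dv hv.
rewrite fineD; last 2 first.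
- by apply: integrable_fin_num => //; exact: integrable_id Du hu.
- by apply: integrable_fin_num => //; exact: integrable_id Dv hv.
rewrite rmorphD /= -(quadratic_form Du hu) -(quadratic_form Dv hv).
have Hu2 := Hl2 Du; have Hv2 := Hl2 Dv.
have uv2 := ell2_lincomb (c := 1) u2 v2.
rewrite Hlin // dot_lincombl // !dot_lincombr //.
(* By symmetry of [H] the cross terms <Hu, v> and <Hv, u> are conjugate, so their sum is twice the
   real part of <Hu, v>. *)
rewrite (self_adjoint_symmetric Dv Du) (dot_conj v2 Hu2) rmorph1 !mul1r.
move=> /(congr1 (@complex.Re R)); rewrite !raddfD /=.
by case: (dot (H u) v) => p q /=; lra.
Qed.

(* Replacing [x] by ['i x = lincomb ('i - 1) x x] gives the imaginary part. *)
Lemma cross_eq0 x y B : measurable B -> D x -> D y ->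
  dot (H (E B x)) (lincomb (-1) (E B y) y) = 0.
Proof.
move=> mB Dx Dy; have DEx := dom_proj mB Dx; have DEy := dom_proj mB Dy.
have re := Re_cross_eq0 mB Dx Dy.
have := Re_cross_eq0 mB (Dlin ('i - 1) Dx Dx) Dy.
have Dv : D (lincomb (-1) (E B y) y) by exact: Dlin.
rewrite (Elin _ mB (Dl2 Dx) (Dl2 Dx)) (Hlin _ DEx DEx).
rewrite (dot_lincombl _ (Hl2 DEx) (Hl2 DEx) (Dl2 Dv)).
case: (dot _ _) re => p q /= -> im; apply/eqP; rewrite eq_complex /=.
by move: im; rewrite eqxx /=; lra.
Qed.

(** [cross_eq0] is used twice. Directly, it replaces [y] by [E B y] against [H (E B x)]. With x and
    y exchanged and [H] moved across, it gives <Hx, E(B)y> = <H E(B)x, E(B)y>. *)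
Lemma dot_proj_op x y B : measurable B -> D x -> D y ->
  dot (E B (H x)) y = dot (H (E B x)) y /\
  dot (H (E B x)) y = dot (H (E B x)) (E B y).
Proof.
move=> mB Dx Dy; have DEx := dom_proj mB Dx; have DEy := dom_proj mB Dy.
have cxy := cross_eq0 mB Dx Dy.
have yE : dot (H (E B x)) y = dot (H (E B x)) (E B y).
  move: cxy; rewrite (dot_lincombr _ (Dl2 DEy) (Dl2 Dy) (Hl2 DEx)).
  rewrite rmorphN1 mulN1r addrC.
  by move/eqP; rewrite subr_eq0 => /eqP.
split=> //; rewrite yE (Esym mB (Hl2 Dx) (Dl2 Dy)).
have Dv : D (lincomb (-1) (E B x) x) by exact: Dlin.
have : dot (H (lincomb (-1) (E B x) x)) (E B y) = 0.
  rewrite (self_adjoint_symmetric Dv DEy) (dot_conj (Dl2 Dv) (Hl2 DEy)).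
  by rewrite cross_eq0 // rmorph0.
rewrite (Hlin _ DEx Dx) (dot_lincombl _ (Hl2 DEx) (Hl2 Dx) (Dl2 DEy)).
rewrite mulN1r addrC.
by move/eqP; rewrite subr_eq0 => /eqP.
Qed.

(** Weak commutation turns the left side into <H E(B)x, E(B)x>, and the spectral measure of E(B)x is
    the restriction of [mu] to [B]. *)
Lemma proj_quadratic_form x mu B : measurable B -> D x ->
  scalar_measure E x mu ->
  dot (E B (H x)) x = real_complex R (Rintegral mu B id).
Proof.
move=> mB Dx h; have [-> ->] := dot_proj_op mB Dx Dx.
rewrite (quadratic_form (dom_proj mB Dx) (scalar_measure_proj mB (Dl2 Dx) h)).
by rewrite /Rintegral integral_mrestr //; exact/measurable_EFinP.
Qed.

(* With [y = H x] and [z c = c y + x], polarization of [A |-> <E A x, y>] and of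
   [B |-> <E B H x, y>] through [z 1] and [z (-1)] keeps all measures positive;
   [square_of_signed_density] then applies on each half-line. *)
Lemma scalar_measure_op x mu
    (kappa : {measure set (measurableTypeR R) -> \bar R}) :
  D x -> D (H x) ->
  scalar_measure E x mu -> scalar_measure E (H x) kappa ->
  forall B, measurable B -> kappa B = (\int[mu]_(t in B) (t ^+ 2)%:E)%E.
Proof.
move=> Dx Dy hmu hka; set y := H x.
have x2 := Dl2 Dx; have y2 := Dl2 Dy; have Hy2 := Hl2 Dy.
pose z c := lincomb c y x.
have Dz c : D (z c) by exact: Dlin.
have [nu1 h1] := scalar_measure_exists (Dl2 (Dz 1)).
have [nu2 h2] := scalar_measure_exists (Dl2 (Dz (-1))).
have EyxE A : measurable A ->
    dot (E A y) x = real_complex R (Rintegral mu A id).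
  by move=> mA; exact: proj_quadratic_form.
have ExyE A : measurable A ->
    dot (E A x) y = real_complex R (Rintegral mu A id).
  move=> mA; rewrite Esym // dot_conj //; last exact: El2.
  by rewrite EyxE //; apply/eqP; rewrite eq_complex /= oppr0 !eqxx.
(* Both cross terms equal the real integral of t over [A], whence the factor 2; passing from c = -1
   to c = 1 doubles it to the 4 of [D12]. *)
have nuE A c : measurable A -> c = 1 \/ c = -1 ->
    complex.Re (dot (E A (z c)) (z c)) =
    complex.Re (dot (E A y) y + dot (E A x) x)
    + complex.Re (c * (real_complex R (2 * Rintegral mu A id))).
  move=> mA c1; have Ax := El2 mA x2; have Ay := El2 mA y2.
  rewrite Elin // dot_lincomb_sym // EyxE // ExyE //.
  by rewrite -rmorphD /= mulr2n mulrDl !mul1r.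
have EHyx B : measurable B -> dot (E B (H y)) x = dot (E B y) y.
  move=> mB; rewrite (dot_proj_op mB Dy Dx).1.
  by rewrite self_adjoint_symmetric //; exact: dom_proj.
(* Here H(z c) = c Hy + y, and by [EHyx] both cross terms equal <E(B)y, y>. *)
have qE B c : measurable B -> c = 1 \/ c = -1 ->
    complex.Re (dot (E B (H (z c))) (z c)) =
    complex.Re (dot (E B (H y)) y + dot (E B y) x)
    + complex.Re (c * (dot (E B y) y *+ 2)).
  move=> mB c1; have Ay := El2 mB y2; have AHy := El2 mB Hy2.
  by rewrite Hlin // Elin // dot_lincomb_sym // EHyx.
have D12 A : measurable A ->
    nu1 A = (nu2 A + (4 * 1 * Rintegral mu A id)%:E)%E.
  move=> mA; rewrite h1 // h2 // -EFinD !nuE //; [|by right|by left].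
  by congr (_%:E); rewrite !mulN1r !mul1r raddfN /=; ring.
have D21 A : measurable A ->
    nu2 A = (nu1 A + (4 * -1 * Rintegral mu A id)%:E)%E.
  by move=> mA; rewrite D12 // -addeA -EFinD mulrN1 mulNr mulr1 subrr adde0.
pose k B := complex.Re (dot (E B y) y).
have I12 B : measurable B ->
    Rintegral nu1 B id = Rintegral nu2 B id + 4 * 1 * k B.
  move=> mB.
  have e c nu : scalar_measure E (z c) nu ->
      Rintegral nu B id = complex.Re (dot (E B (H (z c))) (z c)).
    by move=> h; rewrite (proj_quadratic_form mB (Dz c) h).
  rewrite (e _ _ h1) (e _ _ h2) !qE //; [|by right|by left].
  by rewrite /k; case: (dot (E B y) y) => p q /=; ring.
have I21 B : measurable B ->
    Rintegral nu2 B id = Rintegral nu1 B id + 4 * -1 * k B.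
  by move=> mB; rewrite I12 //; ring.
have imu := integrable_id Dx hmu; have i1 := integrable_id (Dz 1) h1.
have i2 := integrable_id (Dz (-1)) h2.
(* The density t changes sign at 0; on the negative half-line [nu1] and [nu2] exchange roles and s =
   -1. *)
pose P : set (measurableTypeR R) := [set t | 0 <= t].
have mP : measurable P.
  have -> : P = `[0, +oo[%classic.
    by apply/seteqP; split=> t; rewrite /P /= in_itv /= andbT.
  exact: measurable_itv.
move=> B mB.
have mBP : measurable (B `&` P) by exact: measurableI.
have mBN : measurable (B `\` P) by exact: measurableD.
have kP : kappa (B `&` P) = (\int[mu]_(t in B `&` P) (t ^+ 2)%:E)%E.
  rewrite hka //; apply: (@square_of_signed_density _ 1 _ mu nu1 nu2) => //.
  - by rewrite expr1n.
  - by move=> t [_ Pt]; rewrite /= mul1r.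
  - exact: I12.
have kN : kappa (B `\` P) = (\int[mu]_(t in B `\` P) (t ^+ 2)%:E)%E.
  rewrite hka //; apply: (@square_of_signed_density _ (-1) _ mu nu2 nu1) => //.
  - by rewrite sqrrN expr1n.
  - move=> t [_ /negP]; rewrite /= -ltNge mulN1r oppr_ge0; exact: ltW.
  - exact: I21.
transitivity (\int[mu]_(t in B `\` P) (t ^+ 2)%:E
  + \int[mu]_(t in B `&` P) (t ^+ 2)%:E)%E.
  by rewrite (measureDI kappa mB mP); congr (_ + _)%E; [exact: kN|exact: kP].
rewrite -ge0_integral_setU //.
- by rewrite setUC setUIDK.
- by apply/measurable_EFinP; exact: measurable_funX.
- by move=> t _; rewrite lee_fin sqr_ge0.
- by apply/disj_setPS => t [[_ nP] [_ /nP]].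
Qed.

End SpectralResolution.

(** * Moments of a spectral measure *)

Section KrylovMoments.
Variables (R : realType) (a b : nat -> R).

(** The vectors A^m e_1 are real; they are built over [R] and embedded by [complex_krylov] where the
    Hilbert space enters. *)
Definition jacobi_real (x : nat -> R) : nat -> R := fun k =>
  a k.+1 * x k.+1 + (if k is j.+1 then a k * x j else 0) + b k.+1 * x k.

Definition krylov (m : nat) : nat -> R :=
  iter m jacobi_real (fun k => (k == 0%N)%:R).

Lemma krylov_supp m k : (m < k)%N -> krylov m k = 0.
Proof.
elim: m k => [|m IH] [|k] //= mk; have mk' : (m < k)%N by [].
by rewrite /jacobi_real !IH ?mulr0 ?addr0 ?(leqW mk') ?(leqW (leqW mk')).
Qed.

Definition complex_krylov (m : nat) : nat -> R[i] :=
  fun k => real_complex R (krylov m k).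

Lemma complex_krylov0 : complex_krylov 0 = @e1 R.
Proof. by apply/funext => k; rewrite /complex_krylov /e1 /= rmorph_nat. Qed.

Lemma complex_krylovS m : complex_krylov m.+1 = jacobi a b (complex_krylov m).
Proof.
apply/funext => -[|k]; rewrite /complex_krylov /jacobi /= /jacobi_real.
  by rewrite addr0 addr0 rmorphD !rmorphM.
by rewrite !rmorphD !rmorphM.
Qed.

Lemma krylov_finitely_supported m : finitely_supported (complex_krylov m).
Proof.
by exists m.+1 => k mk; rewrite /complex_krylov krylov_supp // rmorph0.
Qed.

Lemma dot_krylov i j n : (i < n)%N ->
  dot (complex_krylov i) (complex_krylov j) =
  real_complex R (\sum_(k < n) krylov i k * krylov j k).
Proof.
move=> i_n; rewrite (@dot_finite _ _ _ n) => [|k nk]; last first.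
  by rewrite /complex_krylov krylov_supp ?rmorph0 // (leq_trans i_n).
rewrite rmorph_sum; apply: eq_bigr => k _; rewrite rmorphM.
by congr (_ * _); apply/eqP; rewrite eq_complex /= oppr0 !eqxx.
Qed.

Variable rho : {measure set (measurableTypeR R) -> \bar R}.
Hypothesis hrho : spectral_measure a b rho.

Lemma dot_krylovS i j : dot (complex_krylov i.+1) (complex_krylov j) =
  dot (complex_krylov i) (complex_krylov j.+1).
Proof.
have [D [H [E [[sa ext] _ _]]]] := hrho.
have DHk k := ext _ (krylov_finitely_supported k).
rewrite !complex_krylovS -(DHk i).2 -(DHk j).2.
exact: (self_adjoint_symmetric sa (DHk i).1 (DHk j).1).
Qed.

(** The spectral measure of A^m e_1 is t^(2m) d rho: its total mass is the even moment, and the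
    quadratic form of [H] at A^m e_1 is the odd one. *)
Lemma moment_even_odd m :
  real_complex R (moment rho (m + m)) =
    dot (complex_krylov m) (complex_krylov m) /\
  real_complex R (moment rho (m + m).+1) =
    dot (complex_krylov m.+1) (complex_krylov m).
Proof.
have [D [H [E [[sa ext] sr hr]]]] := hrho.
have Dk i : D (complex_krylov i).
  by have [] := ext _ (krylov_finitely_supported i).
have Hk i : H (complex_krylov i) = complex_krylov i.+1.
  by rewrite complex_krylovS; have [] := ext _ (krylov_finitely_supported i).
have kl2 i : ell2 (complex_krylov i).
  exact/ell2_finite/krylov_finitely_supported.
have mX k : measurable_fun setT (fun t : measurableTypeR R => (t : R) ^+ k).
  exact: measurable_funX.
(* Induction from [rho] at e_1: each application of A multiplies the density by t^2, by
   [scalar_measure_op]. *)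
have [mu [hmu muE]] : exists mu : {measure set (measurableTypeR R) -> \bar R},
    scalar_measure E (complex_krylov m) mu /\
    forall A, measurable A -> mu A = (\int[rho]_(t in A) (t ^+ (m + m))%:E)%E.
  elim: m => [|m [mu [hmu muE]]].
    exists rho; rewrite complex_krylov0; split=> // A mA.
    under eq_integral do rewrite addn0 expr0.
    by rewrite integral_cst // mul1e.
  have [ka hka] := scalar_measure_exists sr (kl2 m.+1).
  exists ka; split=> // A mA; rewrite -Hk in hka.
  have Dm1 : D (H (complex_krylov m)) by rewrite Hk.
  rewrite (scalar_measure_op sa sr (Dk m) Dm1 hmu hka) //.
  rewrite (@ge0_integral_density _ _ _ rho mu A mA
    (fun t : measurableTypeR R => (t : R) ^+ (m + m))) //.
  - by apply: eq_integral => t _; rewrite -EFinM -exprD addn2 addSn addnS.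
  - by move=> t _; rewrite addnn -muln2 exprM sqr_ge0.
  - by move=> B mB _; exact: muE.
  - by move=> t _; rewrite lee_fin sqr_ge0.
  - by apply/measurable_EFinP; exact: measurable_funTS.
split.
- rewrite /moment /Rintegral -muE // hmu // (roi_setT sr.1) //.
  by rewrite (dot_krylov _ (ltnSn m)).
- rewrite -Hk (quadratic_form sa sr (Dk m) hmu).
  congr (real_complex R _); rewrite /moment /Rintegral; congr fine.
  rewrite (@integral_density _ _ _ rho mu (fun t => t ^+ (m + m)) id) //.
  + by apply: eq_integral => t _; rewrite exprSr.
  + by move=> t; rewrite addnn -muln2 exprM sqr_ge0.
Qed.

(** By symmetry <A^i e_1, A^j e_1> depends only on i + j, so the exponents can be balanced to differ
    by at most one, as in [moment_even_odd]. The sum may stop at [n] because A^i e_1 vanishes from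
    there on. *)
Lemma momentE i j n : (i < n)%N ->
  moment rho (i + j) = \sum_(k < n) krylov i k * krylov j k.
Proof.
move=> i_n; apply: (@complexI R); rewrite -dot_krylov //.
have shift k i' j' : dot (complex_krylov (k + i')) (complex_krylov j') =
    dot (complex_krylov i') (complex_krylov (k + j')).
  by elim: k i' j' => // k IH i' j'; rewrite addSnnS IH dot_krylovS.
have sumE i' j' : dot (complex_krylov i') (complex_krylov j') =
    dot (complex_krylov (i' + j')) (complex_krylov 0).
  by rewrite addnC shift addn0.
rewrite sumE; set s := (i + j)%N; rewrite -(odd_double_half s) -addnn.
have [ev od] := moment_even_odd s./2.
by case: (odd s); rewrite ?add1n ?add0n (od, ev) sumE ?addSn.
Qed.
End KrylovMoments.

(** * Impulse responses and Chebyshev polynomials *)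

Section ChebyshevWave.
Variables (R : realType) (a b : nat -> R).

(** This is the vector p(A) e_1. *)
Definition krylov_poly (p : {poly R}) : nat -> R :=
  fun n => \sum_(k < size p) p`_k * krylov a b k n.

Lemma krylov_poly_wide N (p : {poly R}) n : (size p <= N)%N ->
  krylov_poly p n = \sum_(k < N) p`_k * krylov a b k n.
Proof.
move=> pN; rewrite /krylov_poly.
rewrite (big_ord_widen N (fun k => p`_k * krylov a b k n) pN) big_mkcond.
apply: eq_bigr => k _; case: ltnP => // kp.
by rewrite nth_default // mul0r.
Qed.

Lemma krylov_poly_supp (p : {poly R}) n :
  (size p <= n)%N -> krylov_poly p n = 0.
Proof.
move=> pn; rewrite /krylov_poly big1 // => k _.
by rewrite krylov_supp ?mulr0 // (leq_trans (ltn_ord k)).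
Qed.

Lemma krylov_polyB p q n :
  krylov_poly (p - q) n = krylov_poly p n - krylov_poly q n.
Proof.
have pN := leq_maxl (size p) (size q); have qN := leq_maxr (size p) (size q).
have rN : (size (p - q)%R <= maxn (size p) (size q))%N.
  by rewrite (leq_trans (size_polyD _ _)) // size_polyN.
rewrite (krylov_poly_wide n rN) (krylov_poly_wide n pN) (krylov_poly_wide n qN).
by rewrite -sumrB; apply: eq_bigr => k _; rewrite coefB mulrBl.
Qed.

Lemma jacobi_real_sum N (c : nat -> R) (x : nat -> nat -> R) n :
  jacobi_real a b (fun i => \sum_(k < N) c k * x k i) n =
  \sum_(k < N) c k * jacobi_real a b (x k) n.
Proof.
rewrite /jacobi_real; case: n => [|n].
  rewrite !mulr_sumr addr0 -!big_split /=; apply: eq_bigr => k _; ring.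
rewrite !mulr_sumr -!big_split /=; apply: eq_bigr => k _; ring.
Qed.

Lemma jacobi_krylov_poly (p : {poly R}) n : jacobi_real a b (krylov_poly p) n =
  \sum_(k < size p) p`_k * krylov a b k.+1 n.
Proof. exact: jacobi_real_sum. Qed.

Lemma krylov_polyXM p n :
  krylov_poly ('X * p) n = jacobi_real a b (krylov_poly p) n.
Proof.
have XN : (size ('X * p)%R <= (size p).+1)%N.
  by rewrite (leq_trans (size_polyMleq _ _)) // size_polyX.
rewrite (krylov_poly_wide n XN) jacobi_krylov_poly big_ord_recl.
rewrite coefXM mul0r add0r.
by apply: eq_bigr => k _; rewrite coefXM.
Qed.

Lemma krylov_poly0 n : krylov_poly 0 n = 0.
Proof. by rewrite /krylov_poly size_poly0 big_ord0. Qed.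

Lemma krylov_poly1 n : krylov_poly 1 n = (n == 0%N)%:R.
Proof. by rewrite /krylov_poly size_poly1 big_ord1 coefC eqxx mul1r. Qed.

Let v t := krylov_poly (chebT R t).

Lemma krylov_chebTSS t n : v t.+2 n = jacobi_real a b (v t.+1) n - v t n.
Proof. by rewrite /v krylov_polyB krylov_polyXM. Qed.

Hypothesis a0 : a 0%N = 1.

(* Truncated subtraction is harmless here: [chebT R 0 = 0]. *)
Lemma wave_impulse s (f : nat -> R) : (forall t, f t = (t == s)%:R) ->
  forall t n, wave a b f t n.+1 = v (t - s) n.
Proof.
move=> fE t; elim/ltn_ind: t => -[|[|t]] IH n.
- by rewrite sub0n /v krylov_poly0.
(* At time 1 only an impulse emitted at time 0 has entered, and only into the first component. *)
- rewrite /= !mulr0 addr0 add0r subr0; case: s fE {IH} => [|s] fE.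
    rewrite /v krylov_poly1.
    by case: n => [|n]; rewrite /= ?fE ?a0 ?mulr1 ?mulr0.
  rewrite subSS sub0n /v krylov_poly0.
  by case: n => [|n]; rewrite /= ?fE /= mulr0.
(* In the first component the left neighbour is the boundary value, which [jacobi_real] omits; it
   enters as a separate term with coefficient a_0 = 1. *)
have waveE : wave a b f t.+2 n.+1 = jacobi_real a b (v (t.+1 - s)) n
    + ((n == 0%N) && (t.+1 == s))%:R - v (t - s) n.
  have -> : wave a b f t.+2 n.+1 = a n.+1 * wave a b f t.+1 n.+2
    + a n * wave a b f t.+1 n + b n.+1 * wave a b f t.+1 n.+1
    - wave a b f t n.+1.
    by [].
  rewrite !IH //; congr (_ - _); rewrite /jacobi_real; case: n => [|n].
    by rewrite wave0t fE a0 mul1r /=; ring.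
  by rewrite IH //= ?mulr0n addr0; ring.
(* After the impulse the recurrence of T applies, before it everything vanishes, and at s = t + 1
   the boundary term produces T_1(A) e_1 = e_1. *)
rewrite waveE; case: (ltngtP s t.+1) => st.
- have st' : (s <= t)%N by [].
  rewrite andbF addr0 (subSn (leqW st')) (subSn st').
  by rewrite krylov_chebTSS.
- have J0 : jacobi_real a b (v 0) n = 0.
    by rewrite jacobi_krylov_poly size_poly0 big_ord0.
  have -> : (t.+1 - s = 0)%N by apply/eqP; rewrite subn_eq0 ltnW.
  have -> : (t - s = 0)%N by apply/eqP; rewrite subn_eq0 -ltnS ltnW // ltnW.
  have -> : (t.+2 - s = 0)%N by apply/eqP; rewrite subn_eq0.
  by rewrite J0 /v krylov_poly0 andbF !add0r oppr0.
- have J0 : jacobi_real a b (v 0) n = 0.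
    by rewrite jacobi_krylov_poly size_poly0 big_ord0.
  have -> : (t - s = 0)%N by apply/eqP; rewrite subn_eq0 st.
  rewrite st subnn subSnn J0 /v krylov_poly0 krylov_poly1.
  by rewrite andbT add0r subr0.
Qed.

Lemma control_mxE_krylov T (n s : 'I_T) : control_mx a b T n s = v (T - s) n.
Proof.
rewrite !mxE; apply: wave_impulse => t; rewrite /control.
case: insubP => [i _ <-|].
  by rewrite mxE eqxx andbT.
by rewrite -leqNgt => Tt; rewrite gtn_eqF // (leq_trans (ltn_ord s)).
Qed.

Lemma connecting_mxE T (i j : 'I_T) : connecting_mx a b T i j =
  \sum_(n < T) v (T - i) n * v (T - j) n.
Proof.
rewrite mxE; apply: eq_bigr => n _.
by rewrite [X in X * _]mxE !control_mxE_krylov.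
Qed.

Lemma drop_last_mxE N p (M : 'M[R]_(N.+1, p)) i j :
  (drop_last_mx R N *m M) i j = M (widen_ord (leqnSn N) i) j.
Proof.
rewrite mxE (bigD1 (widen_ord (leqnSn N) i)) //= mxE eqxx mul1r big1 ?addr0 //.
by move=> k; rewrite -val_eqE /= eq_sym => ki; rewrite mxE (negbTE ki) mul0r.
Qed.

Lemma mul_drop_last_mx_tr N p (M : 'M[R]_(p, N.+1)) i j :
  (M *m (drop_last_mx R N)^T) i j = M i (widen_ord (leqnSn N) j).
Proof.
rewrite mxE (bigD1 (widen_ord (leqnSn N) j)) //= !mxE eqxx mulr1 big1 ?addr0 //.
by move=> k; rewrite -val_eqE /= eq_sym => kj; rewrite !mxE (negbTE kj) mulr0.
Qed.

(** With the last row excluded, row i + 1 of [M] always exists, so the adjoint shift leaves no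
    boundary case. *)
Lemma shift_mx_trE N p (M : 'M[R]_(N.+1, p)) (i : 'I_N) j :
  ((shift_mx R N.+1)^T *m M) (widen_ord (leqnSn N) i) j = M (lift ord0 i) j.
Proof.
rewrite mxE (bigD1 (lift ord0 i)) //= !mxE /= eqxx mul1r big1 ?addr0 //.
move=> k; rewrite -val_eqE /= /bump /= add1n => ki.
by rewrite !mxE /= (negbTE ki) mul0r.
Qed.

(** Counting from 0, the first term of B is the entry (i+1, j) of C^(N+1), pairing T_(N-i) with
    T_(N-j+1); the second is the entry (i, j+1) of C^N, pairing T_(N-i) with T_(N-j-1). *)
Lemma B_mxE N (i j : 'I_N) : B_mx a b N i j =
  \sum_(n < N.+1) v (N - i) n * jacobi_real a b (v (N - j)) n.
Proof.
have -> : B_mx a b N i j =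
    connecting_mx a b N.+1 (lift ord0 i) (widen_ord (leqnSn N) j)
    + (connecting_mx a b N *m shift_mx R N) i j.
  rewrite [LHS]mxE; congr (_ + _); rewrite -!mulmxA drop_last_mxE shift_mx_trE.
  by rewrite mulmxA mul_drop_last_mx_tr.
have -> : (connecting_mx a b N *m shift_mx R N) i j =
    \sum_(n < N.+1) v (N - i) n * v (N - j).-1 n.
  (* The added term n = N is zero, since T_(N-i)(A) e_1 is supported in the first N components. *)
  rewrite big_ord_recr /= /v krylov_poly_supp ?mul0r ?addr0; last first.
    by rewrite (size_chebT R _).1 leq_subr.
  rewrite mxE; case: (ltnP j.+1 N) => jN.
    rewrite (bigD1 (Ordinal jN)) //= big1 ?addr0; last first.
      move=> k; rewrite -val_eqE /= => kj.
      by rewrite [shift_mx _ _ _ _]mxE (negbTE kj) mulr0.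
    by rewrite [shift_mx _ _ _ _]mxE eqxx mulr1 connecting_mxE subnS.
  (* The last column of the shift matrix is zero, in agreement with T_0 = 0. *)
  rewrite big1; last first.
    move=> k _; rewrite [shift_mx _ _ _ _]mxE.
    by rewrite ltn_eqF ?mulr0 // (leq_trans (ltn_ord k)).
  have -> : (N - j).-1 = 0%N by rewrite -subnS; apply/eqP; rewrite subn_eq0.
  by rewrite big1 // => n _; rewrite krylov_poly0 mulr0.
rewrite connecting_mxE /= /bump /= add1n subSS -big_split /=.
apply: eq_bigr => n _; rewrite -mulrDr; congr (_ * _).
have Nj : (0 < N - j)%N by rewrite subn_gt0.
by rewrite subSn 1?ltnW // -(prednK Nj) krylov_chebTSS subrK.
Qed.
End ChebyshevWave.

(** * Index reversal and the matrix factorizations *)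

Lemma rev_ord_sub N (i : 'I_N) : (rev_ord i).+1 = (N - i)%N.
Proof. by rewrite /= subnSK. Qed.

Lemma antidiag_mxE (R : realType) N p (M : 'M[R]_(N, p)) i j :
  (antidiag_mx R N *m M) i j = M (rev_ord i) j.
Proof.
rewrite mxE (bigD1 (rev_ord i)) //= mxE eqxx mul1r big1 ?addr0 //.
by move=> k /negbTE ki; rewrite mxE ki mul0r.
Qed.

Lemma mul_antidiag_mxE (R : realType) N p (M : 'M[R]_(p, N)) i j :
  (M *m antidiag_mx R N) i j = M i (rev_ord j).
Proof.
rewrite mxE (bigD1 (rev_ord j)) //= mxE rev_ordK eqxx mulr1 big1 ?addr0 //.
move=> k kj; rewrite mxE -(inj_eq rev_ord_inj) rev_ordK eq_sym (negbTE kj).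
by rewrite mulr0.
Qed.

Lemma antidiag_mx_unit (R : realType) N : antidiag_mx R N \in unitmx.
Proof.
have JJ : antidiag_mx R N *m antidiag_mx R N = 1%:M.
  by apply/matrixP => i j; rewrite antidiag_mxE !mxE rev_ordK eq_sym.
by case: (mulmx1_unit JJ).
Qed.

Lemma Lambda_tildeE (R : realType) N (i j : 'I_N) :
  Lambda_tilde R N i j = (chebT R (N - i))`_(rev_ord j).
Proof.
by rewrite /Lambda_tilde -mulmxA antidiag_mxE mul_antidiag_mxE mxE rev_ord_sub.
Qed.

(** Row i holds the coefficients of a monic polynomial of degree i, so the matrix is unit lower
    triangular. *)
Lemma Lambda_unit (R : realType) N : Lambda R N \in unitmx.
Proof.
rewrite unitmxE det_trig.
  rewrite big1 ?unitr1 // => i _; rewrite mxE.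
  by have [sz <-] := size_chebT R i; rewrite /lead_coef (size_chebT R i.+1).1.
apply/is_trig_mxP => i j ij; rewrite mxE nth_default //.
by rewrite (size_chebT R i.+1).1.
Qed.

Lemma Lambda_tilde_unit (R : realType) N : Lambda_tilde R N \in unitmx.
Proof. by rewrite !unitmx_mul antidiag_mx_unit Lambda_unit. Qed.

(** Reversing both summation indices cancels the reversals inside [Lambda_tilde] and turns [S_mx]
    into the usual Hankel form s_(k+l+m). *)
Lemma Lambda_tilde_mul_S (R : realType) (s : nat -> R) N m (i j : 'I_N) :
  (Lambda_tilde R N *m S_mx s N m *m (Lambda_tilde R N)^T) i j =
  \sum_(k < N) \sum_(l < N)
    (chebT R (N - i))`_k * s (k + l + m)%N * (chebT R (N - j))`_l.
Proof.
rewrite mxE (reindex_inj rev_ord_inj) /= exchange_big /=; apply: eq_bigr => l _.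
rewrite mxE mulr_suml (reindex_inj rev_ord_inj) /=; apply: eq_bigr => k _.
rewrite [(_^T) _ _]mxE !Lambda_tildeE !rev_ordK mxE; congr (_ * s _ * _).
have := ltn_ord k; have := ltn_ord l; rewrite /=; lia.
Qed.

(** The shift [m] counts the extra factors A: 0 for C and 1 for B. The truncation length [M] is
    correspondingly N or N + 1. *)
Lemma krylov_moment_form (R : realType) (a b : nat -> R)
    (rho : {measure set (measurableTypeR R) -> \bar R}) N M m (c d : nat -> R) :
  spectral_measure a b rho -> (N <= M)%N ->
  \sum_(n < M) (\sum_(k < N) c k * krylov a b k n) *
               (\sum_(l < N) d l * krylov a b (l + m) n) =
  \sum_(k < N) \sum_(l < N) c k * moment rho (k + l + m)%N * d l.
Proof.
move=> hrho NM.
under eq_bigr do rewrite mulr_suml; rewrite exchange_big /=.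
apply: eq_bigr => k _; under eq_bigr do rewrite mulr_sumr.
rewrite exchange_big /=; apply: eq_bigr => l _.
rewrite -addnA (momentE hrho _ (leq_trans (ltn_ord k) NM)).
rewrite mulr_sumr mulr_suml; apply: eq_bigr => n _; ring.
Qed.

Theorem theorem4 (R : realType) (a b : nat -> R)
  (rho : {measure set (measurableTypeR R) -> \bar R})
  (ha0 : a 0%N = 1) (ha : forall n : nat, (0 < n)%N -> 0 < a n)
  (hrho : spectral_measure a b rho) (N : nat) (hN : (0 < N)%N) :
  [/\ connecting_mx a b N =
        Lambda_tilde R N *m S_mx (moment rho) N 0 *m (Lambda_tilde R N)^T,
      B_mx a b N =
        Lambda_tilde R N *m S_mx (moment rho) N 1 *m (Lambda_tilde R N)^T,
      bijective (fun f : 'cV[R]_N => (Lambda_tilde R N)^T *m f)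
    & forall (lambda : R) (f g : 'cV[R]_N),
        g = (Lambda_tilde R N)^T *m f ->
        (generalized_eigenpair (B_mx a b N) (connecting_mx a b N) lambda f <->
         generalized_eigenpair (S_mx (moment rho) N 1)
           (S_mx (moment rho) N 0) lambda g)].

Proof.
have szT i : (size (chebT R (N - i)) <= N)%N.
  by rewrite (size_chebT R _).1 leq_subr.
have Lu := Lambda_tilde_unit R N.
have LTu : (Lambda_tilde R N)^T \in unitmx by rewrite unitmx_tr.
have CE : connecting_mx a b N =
    Lambda_tilde R N *m S_mx (moment rho) N 0 *m (Lambda_tilde R N)^T.
  apply/matrixP => i j; rewrite Lambda_tilde_mul_S connecting_mxE //.
  rewrite -(krylov_moment_form _ _ _ hrho (leqnn N)); apply: eq_bigr => n _.
  rewrite !(krylov_poly_wide _ _ _ (szT _)); congr (_ * _).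
  by apply: eq_bigr => k _; rewrite addn0.
have BE : B_mx a b N =
    Lambda_tilde R N *m S_mx (moment rho) N 1 *m (Lambda_tilde R N)^T.
  apply/matrixP => i j; rewrite Lambda_tilde_mul_S B_mxE //.
  rewrite -(krylov_moment_form _ _ _ hrho (leqnSn N)); apply: eq_bigr => n _.
  have -> : krylov_poly a b (chebT R (N - j)) =
      fun l => \sum_(k < N) (chebT R (N - j))`_k * krylov a b k l.
    by apply/funext => l; exact: krylov_poly_wide.
  rewrite (krylov_poly_wide _ _ _ (szT _)) jacobi_real_sum; congr (_ * _).
  by apply: eq_bigr => k _; rewrite addn1.
split=> //.
- exists (mulmx (invmx ((Lambda_tilde R N)^T))) => f.
    by rewrite mulmxA mulVmx // mul1mx.
  by rewrite mulmxA mulmxV // mul1mx.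
- move=> lambda f g; rewrite /generalized_eigenpair CE BE.
  move: (Lambda_tilde R N) Lu LTu => L Lu LTu {CE BE} gE.
  (* Invertibility of the transpose keeps eigenvectors nonzero in both directions. *)
  have -> : (g == 0) = (f == 0).
    apply/eqP/eqP => [g0|f0]; last by rewrite gE f0 mulmx0.
    by rewrite -[f]mul1mx -(mulVmx LTu) -mulmxA -gE g0 mulmx0.
  (* Both sides now carry the invertible factor [L] on the left, which is cancelled or restored. *)
  rewrite -!mulmxA -gE scalemxAr; split=> -[nz fE]; split=> //.
    exact: (can_inj (mulKmx Lu) fE).
  by rewrite fE.
Qed.
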